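(* Let $X$ be a finite dimensional normed space, $A$ a closed set, $f$ l.s.c. on $\Omega$, $\varphi$ l.s.c. on $A \times \{ p_0 \}$, and let $F_{\lambda_0}$ be bounded below on $A \times P$ for some $\lambda_0 \ge 0$. Suppose that there exists a non-decreasing function $\omega \colon \mathbb{R}_+ \to \mathbb{R}_+$ such that $\omega(t) = 0$ iff $t = 0$, and $\varphi(x, p) \ge \omega(d(p, p_0))$ for all $(x, p) \in A \times P$. Then for the parametric penalty function $F_{\lambda}$ to be exact on every bounded subset of the set $A$ it is necessary and sufficient that $F_{\lambda}$ is exact at every globally optimal solution of the problem $(\mathcal{P})$.
   Context: Setting. $M, A \subset X$ are nonempty, $f \colon X \to \mathbb{R} \cup \{+\infty\}$ with $\operatorname{dom} f = \{x : |f(x)| < +\infty\} \ne \emptyset$. The problem $(\mathcal{P})$ is: minimize $f(x)$ subject to $x \in M$, $x \in A$. Put $\Omega = M \cap A$; it is assumed that $f$ attains a global minimum on $\Omega$, with finite value $f^* = \min_{x\in\Omega} f(x)$. $P$ is a metric space, $p_0 \in P$ is fixed, and $\varphi \colon X \times P \to [0, +\infty]$ satisfies $\varphi(x, p) = 0$ iff $p = p_0$ and $x \in M$. The parametric penalty function is $F_{\lambda}(x, p) = f(x) + \lambda \varphi(x, p)$, $\lambda \ge 0$. $\mathbb{R}_+ = [0, +\infty)$. Exactness on a set: for a nonempty set $A_0 \subset A$, $F_\lambda$ is exact on $A_0$ if there exists $\lambda' \ge 0$ such that $F_{\lambda'}(x, p) \ge f^*$ for all $(x, p) \in A_0 \times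 P$. Local exactness: $F_\lambda$ is exact at a locally optimal solution $x^* \in \operatorname{dom} f$ of $(\mathcal{P})$ if there exists $\lambda' \ge 0$ such that $(x^*, p_0)$ is a local minimizer of $F_{\lambda'}$ on $A \times P$. ''L.s.c. on a set'' means lower semicontinuous at every point of that set. *)

(* Defs.v *)
From HB Require Import structures.
From mathcomp Require Import all_boot all_order all_algebra.
From mathcomp Require Import all_classical all_reals all_analysis.

Set Implicit Arguments.
Unset Strict Implicit.
Unset Printing Implicit Defensive.

Import Order.TTheory GRing.Theory Num.Theory.
Import numFieldNormedType.Exports.

Local Open Scope classical_set_scope.
Local Open Scope ring_scope.
Local Open Scope ereal_scope.

(* Finite-dimensional normed spaces: the norm and its topology come from
   [normedModType], finite dimension from [vectType]. *)
#[short(type="normedVectType")]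
HB.structure Definition NormedVector (K : numDomainType) :=
  {V of NormedModule K V & Vector K V}.

(* [lower_semicontinuous f] is [forall x, lsc_at f x]. *)
Definition lsc_at (R : realType) (T : topologicalType) (f : T -> \bar R)
    (x : T) : Prop :=
  forall a : R, a%:E < f x -> exists2 V, nbhs x V & forall y, V y -> a%:E < f y.

(* The neighbourhoods are those of [T], not of the subspace [D]. *)
Definition lsc_on (R : realType) (T : topologicalType) (D : set T)
    (f : T -> \bar R) : Prop :=
  forall x, D x -> lsc_at f x.

Definition edom (R : realType) (T : Type) (f : T -> \bar R) : set T :=
  [set x | `|f x| < +oo].

Definition global_minimizer (R : realType) (T : Type) (D : set T)
    (f : T -> \bar R) (x : T) : Prop :=
  D x /\ forall y, D y -> f x <= f y.

Definition local_minimizer (R : realType) (T : topologicalType) (D : set T)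
    (f : T -> \bar R) (x : T) : Prop :=
  D x /\ \forall y \near x, D y -> f x <= f y.

(* The library convention is [0 * +oo = 0], so [penalty f phi 0 (x, p) = f x]. *)
Definition penalty (R : realType) (X P : Type) (f : X -> \bar R)
    (phi : X * P -> \bar R) (lambda : R) : X * P -> \bar R :=
  fun z => f z.1 + lambda%:E * phi z.

Definition exact_on (R : realType) (X P : Type) (f : X -> \bar R)
    (phi : X * P -> \bar R) (fstar : R) (A0 : set X) : Prop :=
  exists2 lambda : R, (0 <= lambda)%R &
    forall x p, A0 x -> fstar%:E <= penalty f phi lambda (x, p).

Definition exact_at (R : realType) (X P : topologicalType) (f : X -> \bar R)
    (phi : X * P -> \bar R) (A : set X) (p0 : P) (x : X) : Prop :=
  exists2 lambda : R, (0 <= lambda)%R &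
    local_minimizer (A `*` [set: P]) (penalty f phi lambda) (x, p0).

(* Main.v *)
(* For sufficiency, bounded subsets of [A] sit in a compact set, so by
   near-covering it is enough to show that near each [x] in [A], uniformly in
   [p], [F_lambda >= f*] for large [lambda].  Points with [p] far from [p0] are
   handled by [omega].  Near [(x, p0)]: if [x] is not in [M], then [phi] is
   bounded away from 0 by lower semicontinuity; if [f x > f*], use lower
   semicontinuity of [f]; otherwise [x] is a global minimizer and exactness at
   [x] applies.  Wherever [phi] is bounded away from 0, the bound on
   [F_lambda0] makes [F_lambda] exceed [f*] for large [lambda]. *)

Require Import Defs.
From HB Require Import structures.
From mathcomp Require Import all_boot all_order all_algebra.
From mathcomp Require Import all_classical all_reals all_analysis.

Set Implicit Arguments.
Unset Strict Implicit.
Unset Printing Implicit Defensive.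

Import Order.TTheory GRing.Theory Num.Theory.
Import numFieldNormedType.Exports.
Import VectorInternalTheory.

Local Open Scope classical_set_scope.
Local Open Scope ring_scope.
Local Open Scope ereal_scope.

(** Expanding [x] in the standard basis bounds [|g x|] by [|x|] times the sum of the
    [|g (delta_mx ord0 i)|], since no coordinate exceeds the max norm; a bounded linear map is
    continuous. *)
Lemma continuous_linear_rV (R : realType) n (V : normedModType R)
  (g : {linear 'rV[R]_n -> V}) : continuous g.
Proof.
apply/linear_bounded_continuous/linear_boundedP; near=> r => x.
have -> : g x = (\sum_(i < n) x ord0 i *: g (delta_mx ord0 i))%R.
  rewrite {1}(row_sum_delta x) linear_sum.
  by apply: eq_bigr => i _; rewrite linearZ.
apply: le_trans (ler_norm_sum _ _ _) _.
apply: (@le_trans _ _ (\sum_(i < n) `|x| * `|g (delta_mx ord0 i)|)%R).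
  apply: ler_sum => i _; rewrite normrZ ler_wpM2r//.
  rewrite [leRHS]/Num.norm/= mx_normrE.
  by rewrite (le_bigmax _ (fun ij => `|x ij.1 ij.2|%R) (ord0, i)).
by rewrite -mulr_sumr mulrC ler_wpM2r.
Unshelve. all: by end_near. Qed.

(* [r2v] attains a positive minimum of the norm on the unit sphere, by
   injectivity; hence it maps some closed ball onto a set containing [B]. *)
Lemma bounded_sub_compact (R : realType) (X : normedVectType R) (B : set X) :
  bounded_set B -> exists2 K : set X, compact K & B `<=` K.
Proof.
move=> /ex_strict_bound_gt0[M M0 BM].
have r2vC : continuous (r2v : 'rV[R]_(dim X) -> X).
  exact: continuous_linear_rV.
pose S := [set v : 'rV[R]_(dim X) | `|v|%R = 1%R].
have cS : compact S.
  apply: bounded_closed_compact.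
    by exists 1%R; split; [exact: num_real|move=> y y1 v /= ->; exact: ltW].
  apply: (closed_comp (f := fun v : 'rV[R]_(dim X) => `|v|%R) (D := [set 1%R])).
    by move=> v _; exact: norm_continuous.
  exact: closed_eq.
have normalize (v : 'rV[R]_(dim X)) : v != 0%R -> S (`|v|^-1 *: v)%R.
  by move=> v0; rewrite /S/= normrZ normfV normr_id mulVf ?normr_eq0.
have [m m0 mle] : exists2 m : R, (0 < m)%R &
    forall v : 'rV[R]_(dim X), (m * `|v| <= `|r2v v : X|)%R.
  (* The sphere is empty when [dim X] is 0; every [v] is then zero and any positive [m] will do. *)
  have [S0|/set0P/negP/negPn/eqP S0] := pselect (S !=set0); last first.
    exists 1%R => // v; have [->|/normalize] := eqVneq v 0%R.
      by rewrite normr0 mulr0.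
    by rewrite S0.
  have [|u uS umin] := @compact_EVT_min _ R
      (fun v : 'rV[R]_(dim X) => `|r2v v : X|%R) S S0 cS.
    apply: continuous_subspaceT => v.
    by apply: continuous_comp; [exact: r2vC|exact: norm_continuous].
  exists `|r2v u : X|%R.
    rewrite normr_gt0; apply/eqP => ru0; move: uS; rewrite inE /S/=.
    have -> : u = 0%R by apply: r2v_inj; rewrite ru0 linear0.
    by rewrite normr0 => /eqP; rewrite eq_sym oner_eq0.
  move=> v; have [->|v0] := eqVneq v 0%R; first by rewrite normr0 mulr0.
  have /mem_set/umin := normalize _ v0.
  by rewrite linearZ/= normrZ normfV normr_id ler_pdivlMl ?normr_gt0 // mulrC.
(* The radius comes from [m * |v| <= |r2v v| < M], applied to the coordinate vector [v2r x] of a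
   point [x] of [B]. *)
exists (r2v @` [set v : 'rV[R]_(dim X) | `|v|%R <= m^-1 * M]%R).
  apply: continuous_compact; first exact: continuous_subspaceT.
  apply: bounded_closed_compact.
    exists (m^-1 * M)%R; split; first exact: num_real.
    by move=> y y1 v /= /le_trans; apply; exact: ltW.
  apply: (closed_comp (f := fun v : 'rV[R]_(dim X) => `|v|%R)
    (D := [set y | y <= m^-1 * M]%R)).
    by move=> v _; exact: norm_continuous.
  exact: closed_le.
move=> x Bx; exists (v2r x); last exact: v2rK.
rewrite /= ler_pdivlMl//; apply: le_trans (mle _) _.
by rewrite v2rK; apply/ltW/BM.
Qed.

Section penalty.
Context (R : realType) (X P : Type) (f : X -> \bar R) (phi : X * P -> \bar R).
Hypothesis phi_ge0 : forall z, 0 <= phi z.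

(** Nonnegativity of [a] and [b] permits distributing over a [phi z] that may be [+oo]. *)
Lemma penaltyD (a b : R) z : (0 <= a)%R -> (0 <= b)%R ->
  penalty f phi (a + b) z = penalty f phi a z + b%:E * phi z.
Proof.
by move=> a0 b0; rewrite /penalty EFinD ge0_muleDl ?lee_fin// addeA.
Qed.

Lemma penalty_le (a b : R) z : (0 <= a)%R -> (a <= b)%R ->
  penalty f phi a z <= penalty f phi b z.
Proof.
move=> a0 ab; rewrite -(subrK a b) addrC penaltyD ?subr_ge0//.
by rewrite leeDl// mule_ge0// lee_fin subr_ge0.
Qed.

Lemma penalty_zero (a : R) z : phi z = 0 -> penalty f phi a z = f z.1.
Proof. by rewrite /penalty => ->; rewrite mule0 adde0. Qed.

(** Past [lambda0] the penalty is at least [c + (lambda - lambda0) * b], so it suffices that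
    [lambda] exceed both [lambda0] and [lambda0 + (y - c) / b], which depend on neither [x] nor
    [p]. *)
Lemma penalty_ge_near (A : set X) (b y : R) :
  (exists2 lambda0 : R, (0 <= lambda0)%R & exists c : R,
    forall x p, A x -> c%:E <= penalty f phi lambda0 (x, p)) ->
  (0 < b)%R ->
  \forall lambda \near +oo%R, forall x p, A x -> b%:E <= phi (x, p) ->
    y%:E <= penalty f phi lambda (x, p).
Proof.
move=> [lambda0 l0 [c cF]] b0; near=> l => x p Ax bphi.
have ll : (lambda0 <= l)%R.
  by near: l; apply: nbhs_pinfty_ge; rewrite num_real.
rewrite -(subrK lambda0 l) addrC penaltyD ?subr_ge0//.
apply: le_trans (leeD (cF _ _ Ax) (lee_wpmul2l _ bphi)); last first.
  by rewrite lee_fin subr_ge0.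
rewrite -EFinM -EFinD lee_fin -lerBlDl -ler_pdivrMr// lerBrDr.
by near: l; apply: nbhs_pinfty_ge; rewrite num_real.
Unshelve. all: by end_near. Qed.

End penalty.

(** The value at [(x, p0)] is [fstar] for every [lambda], so a lower bound by [fstar] over the ball
    and all [p] already is local minimality. *)
Lemma exact_on_ball_exact_at (R : realType) (X : normedModType R)
    (P : metricType R) (M A : set X) (f : X -> \bar R) (p0 : P)
    (phi : X * P -> \bar R) (fstar : R) (x : X) :
  (forall x p, phi (x, p) = 0 <-> p = p0 /\ M x) ->
  f x = fstar%:E -> M x -> A x ->
  exact_on f phi fstar (A `&` ball x 1%R) -> exact_at f phi A p0 x.
Proof.
move=> phi0 fx Mx Ax [l l0 lP]; exists l => //; split=> //.
rewrite penalty_zero/= ?fx; last exact/phi0.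
exists (ball x 1%R, setT) => /=.
  by split; [exact: nbhsx_ballx|exact: filterT].
by move=> [y p] /= [xy _] [Ay _]; exact: lP.
Qed.

Section near_penalty.
Context (R : realType) (X : topologicalType) (P : metricType R).
Context (A : set X) (f : X -> \bar R) (p0 : P) (phi : X * P -> \bar R).
Context (fstar : R) (omega : R -> R).
Hypothesis phi_ge0 : forall z, 0 <= phi z.
Hypothesis F_bounded_below : exists2 lambda0 : R, (0 <= lambda0)%R &
  exists c : R, forall x p, A x -> c%:E <= penalty f phi lambda0 (x, p).
Hypothesis omega_ge0 : forall t : R, (0 <= t)%R -> (0 <= omega t)%R.
Hypothesis omega_homo :
  forall s t : R, (0 <= s)%R -> (s <= t)%R -> (omega s <= omega t)%R.
Hypothesis omega_eq0 :
  forall t : R, (0 <= t)%R -> (omega t = 0%R <-> t = 0%R).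
Hypothesis omega_phi :
  forall x p, A x -> (omega (mdist p p0))%:E <= phi (x, p).

(* Away from [p0] the growth of [phi] alone makes the penalty large, so only
   the points near [(x, p0)] matter. *)
Lemma near_penalty_ge (x : X) :
  (\forall z \near (x, p0) & lambda \near +oo%R,
    A z.1 -> fstar%:E <= penalty f phi lambda z) ->
  \forall y \near x & lambda \near +oo%R,
    A y -> forall p, fstar%:E <= penalty f phi lambda (y, p).
Proof.
move=> [[W L] /= [[[U V] /= [xU p0V] UVW] Loo] WL].
have /nbhs_ballP[e /= e0 eV] := p0V.
have we0 : (0 < omega e)%R.
  rewrite lt_neqAle omega_ge0 ?ltW// andbT eq_sym.
  by apply/eqP => /(omega_eq0 (ltW e0)) e_eq0; rewrite e_eq0 ltxx in e0.
(* The extra condition on [l] serves the points with [mdist p p0 >= e], where monotonicity gives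
   [phi >= omega e > 0]. *)
exists (U, L `&` [set l | forall x p, A x -> (omega e)%:E <= phi (x, p) ->
    fstar%:E <= penalty f phi l (x, p)]) => /=.
  by split=> //; apply: filterI => //; exact: penalty_ge_near.
move=> [y l] /= [Uy [Ll farl]] Ay p.
have [pe|pe] := ltP (mdist p p0) e.
  apply: (WL ((y, p), l)) => //=; split=> //; apply: UVW; split => //=.
  by apply: eV; rewrite ballEmdist/= metric_sym.
apply: farl => //; apply: le_trans (omega_phi _ Ay).
by rewrite lee_fin omega_homo// ltW.
Qed.

(** The conclusion, joint in [y] and [lambda], is what near-covering turns into a single threshold
    on a compact set. *)
Lemma near_exact (M : set X) (x : X) :
  (forall x p, phi (x, p) = 0 <-> p = p0 /\ M x) ->
  (forall y, (M `&` A) y -> fstar%:E <= f y) ->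
  A x -> (M x -> lsc_at f x) -> lsc_at phi (x, p0) ->
  (M x -> f x = fstar%:E -> exact_at f phi A p0 x) ->
  \forall y \near x & lambda \near +oo%R,
    A y -> forall p, fstar%:E <= penalty f phi lambda (y, p).
Proof.
move=> phi0 fmin Ax flsc philsc ex; apply: near_penalty_ge.
have [Mx|nMx] := pselect (M x).
  have := fmin _ (conj Mx Ax); rewrite le_eqVlt => /predU1P[fx|/(flsc Mx) [U xU fU]].
    (* Exactness gives only one multiplier [l1]; monotonicity in [lambda] carries the bound to all
       larger ones. *)
    have [l1 l10 [_ xW]] := ex Mx (esym fx).
    rewrite penalty_zero/= -?fx in xW; last exact/phi0.
    exists ([set z | (A `*` setT) z -> fstar%:E <= penalty f phi l1 z],
      [set l | (l1 <= l)%R]) => /=.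
      by split=> //; apply: nbhs_pinfty_ge; exact: num_real.
    move=> [z l] /= [Wz l1l] Az; apply: le_trans (Wz _) _ => //.
    exact: penalty_le.
  exists (U `*` setT, [set l | (0 <= l)%R]) => /=.
    split; last by apply: nbhs_pinfty_ge; exact: num_real.
    by exists (U, setT) => //=; split => //; exact: filterT.
  move=> [[y p] l] /= [[Uy _] l_ge0] _; apply: le_trans (ltW (fU _ Uy)) _.
  by rewrite leeDl// mule_ge0.
have : 0 < phi (x, p0).
  by rewrite lt_neqAle phi_ge0 andbT eq_sym; apply/eqP => /phi0[].
(* A real level below [phi (x, p0)]: half of it if finite, 1 if it is [+oo]. *)
move=> phi_gt0; have [a a0 aphi] : exists2 a : R, (0 < a)%R & a%:E < phi (x, p0).
  case: (phi (x, p0)) phi_gt0 => [r| |]//; last by exists 1%R; rewrite // ltry.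
  rewrite lte_fin => r0; exists (r / 2)%R; first exact: divr_gt0.
  by rewrite lte_fin ltr_pdivrMr// ltr_pMr// ltr1n.
have [W Wx Wphi] := philsc _ aphi.
exists (W, [set l | forall x p, A x -> a%:E <= phi (x, p) ->
    fstar%:E <= penalty f phi l (x, p)]) => /=.
  by split=> //; exact: penalty_ge_near.
by move=> [[y p] l] /= [Wz lF] Az; apply: lF => //; exact/ltW/Wphi.
Qed.

End near_penalty.

Theorem theorem3p9 (R : realType) (X : normedVectType R) (P : metricType R)
  (M A : set X) (f : X -> \bar R) (p0 : P) (phi : X * P -> \bar R) (fstar : R)
  (M_neq0 : M !=set0) (A_neq0 : A !=set0)
  (f_neqNy : forall x, f x != -oo) (domf_neq0 : edom f !=set0)
  (fstar_min : exists2 x, global_minimizer (M `&` A) f x & f x = fstar%:E)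
  (phi_ge0 : forall z, 0 <= phi z)
  (phi_eq0 : forall x p, phi (x, p) = 0 <-> p = p0 /\ M x)
  (A_closed : closed A)
  (f_lsc : lsc_on (M `&` A) f)
  (phi_lsc : lsc_on (A `*` [set p0]) phi)
  (F_bounded_below : exists2 lambda0 : R, (0 <= lambda0)%R &
     exists c : R, forall x p, A x -> c%:E <= penalty f phi lambda0 (x, p))
  (omega_minorant : exists omega : R -> R,
     [/\ forall t : R, (0 <= t)%R -> (0 <= omega t)%R,
         forall s t : R, (0 <= s)%R -> (s <= t)%R -> (omega s <= omega t)%R,
         forall t : R, (0 <= t)%R -> (omega t = 0%R <-> t = 0%R) &
         forall x p, A x -> (omega (mdist p p0))%:E <= phi (x, p)]) :
  (forall A0 : set X, A0 !=set0 -> A0 `<=` A -> bounded_set A0 ->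
     exact_on f phi fstar A0) <->
  (forall x, global_minimizer (M `&` A) f x -> exact_at f phi A p0 x).
Proof.
have [xs [[Mxs Axs] xsmin] fxs] := fstar_min.
split=> [ex x [[Mx Ax] xmin]|ex A0 _ A0A bA0].
  (* Necessity: exactness is applied to the part of [A] in the unit ball about [x], bounded in norm
     by [|x| + 1]. *)
  apply: (@exact_on_ball_exact_at _ _ _ M _ _ _ _ fstar) => //.
    by apply/eqP; rewrite eq_le -{1}fxs xmin//= -fxs xsmin.
  apply: ex; [by exists x; split => //; exact: ballxx|by move=> ? []|].
  exists (`|x| + 1)%R; split; first exact: num_real.
  move=> y xy z [_]; rewrite -ball_normE/= => xz.
  have -> : z = (x - (x - z))%R by rewrite opprB addrC subrK.
  apply: le_trans (ler_normB _ _) _; apply: le_trans (ltW xy).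
  by rewrite lerD2l ltW.
have [omega [w0 wle weq wphi]] := omega_minorant.
have [K cK A0K] := bounded_sub_compact bA0.
have Kex : \forall l \near +oo%R, K `<=` (fun y => A y -> forall p,
    fstar%:E <= penalty f phi l (y, p)).
  apply: (proj1 (compact_near_coveringP K) cK) => x _.
  (* [K] need not lie in [A]; near a point outside the closed set [A] the claim is vacuous. *)
  have [Ax|nAx] := pselect (A x); last first.
    exists (~` A, setT) => /=; last by move=> [y l] [].
    split; last exact: filterT.
    by apply: open_nbhs_nbhs; split => //; exact: closed_openC.
  apply: (@near_exact _ _ _ _ _ p0 _ _ omega _ _ _ _ _ _ M) => //.
  - by move=> y My; rewrite -fxs; exact: xsmin.
  - by move=> Mx; exact: f_lsc.
  - exact: phi_lsc.
  - move=> Mx fx; apply: ex; split => // y My.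
    by rewrite fx -fxs; exact: xsmin.
(* Both conditions hold eventually, so some real [l] satisfies them together. *)
have : \forall l \near +oo%R, (0 <= l :> R)%R /\ K `<=` (fun y => A y ->
    forall p, fstar%:E <= penalty f phi l (y, p)).
  by apply: filterI => //; apply: nbhs_pinfty_ge; exact: num_real.
move=> /filter_ex[l [l0 lK]]; exists l => // x p A0x.
by apply: lK; [exact: A0K|exact: A0A].
Qed.
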